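(* Let $p>1$ and let $G=(V,E)$ be a finite connected graph with vertex measure $\mu$ and symmetric edge measure $\omega$. Let $h\in C(V)$ with $h\not\equiv 0$. Then the equation $$\Delta_p u=-he^{u}\quad\text{in } V$$ has a solution $u\in C(V)$ if and only if $h$ changes sign and $\overline{h}<0$.
   Context: $G=(V,E)$ is a finite connected graph with vertex set $V$ and edge set $E$; $i\sim j$ means that $i,j\in V$ are joined by an edge. $\mu:V\to(0,+\infty)$ is a fixed vertex measure and $\omega:E\to(0,+\infty)$ is a fixed edge measure, symmetric: $\omega_{ij}=\omega_{ji}$ for each edge $i\sim j$. $C(V)$ is the finite-dimensional vector space of all real functions on $V$. For $p>1$ the discrete $p$-Laplacian $\Delta_p:C(V)\to C(V)$ is $$\Delta_p f_i=\frac{1}{\mu_i}\sum_{j\sim i}\omega_{ij}|f_j-f_i|^{p-2}(f_j-f_i),\qquad i\in V,$$ where $|t|^{p-2}t$ is understood to be $0$ at $t=0$. For $f\in C(V)$, $\overline{f}=\big(\sum_{i\in V}\mu_i f_i\big)/\big(\sum_{i\in V}\mu_i\big)$ is the average of $f$ with respect to $\mu$. ''$h$ changes sign'' means that $h$ is positive at some vertex and negative at some vertex. *)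

(* Defs.v *)
From HB Require Import structures.
From mathcomp Require Import all_boot all_order all_algebra.
From mathcomp Require Import reals sequences exp.

Set Implicit Arguments.
Unset Strict Implicit.
Unset Printing Implicit Defensive.

Import Order.TTheory GRing.Theory Num.Theory.

Local Open Scope ring_scope.

Definition simple_graph (V : finType) (adj : rel V) : Prop :=
  symmetric adj /\ irreflexive adj.

Definition connected_graph (V : finType) (adj : rel V) : Prop :=
  forall i j : V, connect adj i j.

Definition vertex_measure (R : realType) (V : finType) (mu : V -> R) : Prop :=
  forall i : V, 0 < mu i.

(* The values of omega at non-adjacent pairs are unconstrained and never used:
   only its restriction to the edges is meaningful. *)
Definition edge_measure (R : realType) (V : finType) (adj : rel V)
    (omega : V -> V -> R) : Prop :=
  forall i j : V, adj i j -> 0 < omega i j /\ omega i j = omega j i.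

(* The factor f j - f i makes a summand vanish when f j = f i, whatever value
   powR gives to 0 `^ (p - 2); this is the convention |t|^(p-2) t = 0 at t = 0. *)
Definition pLaplacian (R : realType) (V : finType) (adj : rel V)
    (mu : V -> R) (omega : V -> V -> R) (p : R) (f : V -> R) : V -> R :=
  fun i => (mu i)^-1 *
    \sum_(j | adj i j) omega i j * `|f j - f i| `^ (p - 2) * (f j - f i).

Definition average (R : realType) (V : finType) (mu : V -> R) (f : V -> R) : R :=
  (\sum_i mu i * f i) / (\sum_i mu i).

Definition changes_sign (R : realType) (V : finType) (h : V -> R) : Prop :=
  (exists i, 0 < h i) /\ (exists i, h i < 0).

(* Main.v *)
Require Import Defs.
From HB Require Import structures.
From mathcomp Require Import all_boot all_order all_algebra.
From mathcomp Require Import ring lra.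
From mathcomp Require Import boolp classical_sets.
From mathcomp Require Import reals topology normedtype.
From mathcomp Require Import sequences derive exp.

(** The equation is variational.  Write
      E u = \sum_(i ~ j) omega_ij |u_j - u_i|^p   (over ordered pairs),
      G u = \sum_i mu_i h_i e^(u_i).
    Summation by parts ([dpairing_pLaplacian]) identifies the p-Laplacian with
    the differential of E, up to the factor - 2 p and the weights mu.

    Necessity.  Pairing the equation with the constant 1 gives G u = 0, so h,
    not being identically zero, changes sign.  Pairing it with e^(-u) gives
    2 \sum_i mu_i h_i as a sum of the terms
    omega_ij |d|^(p-2) d (e^(-u_j) - e^(-u_i)), with d = u_j - u_i, all
    nonpositive because exp (- _) is decreasing.  If the sum vanished, u would be
    constant by connectedness, hence its p-Laplacian and h would be zero.

    Sufficiency.  E is minimised over {G >= 0}.  This set is nonempty since h is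
    positive somewhere, and both E and the sign of G are invariant under adding
    a constant, so u may be pinned to 0 at one vertex; on a connected graph a
    bound on E then bounds every coordinate, and compactness gives a minimiser u
    ([penergy_min_on_weight]).  If phi is a direction with dG(u) phi > 0, then
    u + t phi stays in {G >= 0} for small t > 0, so dE(u) phi >= 0
    ([minimizer_dpairing_ge0]).  Two linear forms, the second nonnegative where
    the first is positive, are proportional ([halfspace_proportional]): this is
    the Lagrange multiplier rule, and it yields Delta_p u = - lam h e^u with
    lam >= 0.  If lam were 0, u would be constant, and then
    G u = e^u \sum_i mu_i h_i < 0, which is excluded.  So lam > 0 and u + ln lam
    solves the equation.

    E and G are never differentiated: the one-sided inequalities come from the
    convexity of |x|^p (Young's inequality) and of exp, together with the
    continuity of |x|^(p-2) x. *)

Set Implicit Arguments.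
Unset Strict Implicit.
Unset Printing Implicit Defensive.

Import Order.TTheory GRing.Theory Num.Theory.
Import numFieldTopology.Exports numFieldNormedType.Exports.

Local Open Scope classical_set_scope.
Local Open Scope ring_scope.

(** * Auxiliary facts *)

(** Induction along a path. *)
Lemma connect_ind (V : finType) (adj : rel V) (P : V -> Prop) :
  (forall i j, adj i j -> P i -> P j) ->
  forall i j, connect adj i j -> P i -> P j.
Proof.
move=> Padj i j /connectP[s]; elim: s i => [|k s IH] i /=; first by move=> _ ->.
by move=> /andP[ik sk] e Pi; apply: IH sk e (Padj _ _ ik Pi).
Qed.

Lemma continuous_bigsum (R : realType) (I : finType) (P : pred I)
    (T : topologicalType) (f : I -> T -> R) :
  (forall i, P i -> continuous (f i)) ->
  continuous (fun x => \sum_(i | P i) f i x).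
Proof. by move=> h; apply: continuous_big => //; exact: add_continuous. Qed.

(** The graph of exp lies above its tangent line at b. *)
Lemma expR_tangent (R : realType) (a b : R) : expR b * (1 + (a - b)) <= expR a.
Proof.
have -> : expR a = expR b * expR (a - b) by rewrite -expRD subrKC.
by rewrite ler_pM2l ?expR_gt0// expR_ge1Dx.
Qed.

(** A linear form b that is nonnegative wherever the nonzero form a is positive
    is a nonnegative multiple of a: on the affine hyperplane where a takes the
    value a i0, the form b is bounded below, hence constant. *)
Lemma halfspace_proportional (R : realFieldType) (I : finType)
    (a b : I -> R) (i0 : I) :
  0 < a i0 ->
  (forall phi : I -> R, 0 < \sum_i a i * phi i -> 0 <= \sum_i b i * phi i) ->
  exists2 lam, 0 <= lam & forall i, b i = lam * a i.
Proof.
move=> a0 H; pose delta (k i : I) : R := (i == k)%:R.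
have sd (c : I -> R) k : \sum_i c i * delta k i = c k.
  rewrite (bigD1 k)//= /delta eqxx mulr1 big1 ?addr0// => i /negbTE ->.
  by rewrite mulr0.
have sD (c : I -> R) s r i :
    \sum_k c k * (delta i0 k + s * (delta i k - r * delta i0 k)) =
    c i0 + s * (c i - r * c i0).
  rewrite -(sd c i0) -(sd c i) !mulr_sumr -sumrB mulr_sumr -big_split/=.
  by apply: eq_bigr => k _; ring.
have b0 : 0 <= b i0 by rewrite -sd; apply: H; rewrite sd.
exists (b i0 / a i0) => [|i]; first by rewrite divr_ge0// ltW.
pose d := b i - b i0 / a i0 * a i.
have Hs s : 0 <= b i0 + s * d.
  have -> : d = b i - a i / a i0 * b i0 by rewrite /d; ring.
  rewrite -sD; apply: H; rewrite sD.
  have -> : a i - a i / a i0 * a i0 = 0 by field; rewrite gt_eqF.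
  by rewrite mulr0 addr0.
apply/eqP; rewrite -subr_eq0 -/d; apply/negP => /negP d0.
(* s is chosen to make the affine function s |-> b i0 + s * d equal to -1 *)
have := Hs (- (b i0 + 1) / d); rewrite divfK//; lra.
Qed.

(** * The scalar flux |x|^(p-2) x *)

(** The odd function |x|^(p-2) x; it is 0 at 0 whatever the value of 0^(p-2). *)
Definition pflux (R : realType) (p x : R) : R := `|x| `^ (p - 2) * x.

Lemma pfluxN (R : realType) (p x : R) : pflux p (- x) = - pflux p x.
Proof. by rewrite /pflux normrN mulrN. Qed.

Lemma norm_pflux (R : realType) (p x : R) :
  1 < p -> `|pflux p x| = `|x| `^ (p - 1).
Proof.
move=> p1; have [->|x0] := eqVneq x 0.
  by rewrite /pflux mulr0 normr0 powR0// subr_eq0 gt_eqF.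
have -> : p - 1 = (p - 2) + 1 by ring.
rewrite powRD; last by rewrite normr_eq0 x0 implybT.
by rewrite /pflux normrM (ger0_norm (powR_ge0 _ _)) powRr1.
Qed.

Lemma mul_pflux (R : realType) (p x : R) : 1 < p -> x * pflux p x = `|x| `^ p.
Proof.
move=> p1; rewrite -[RHS]mulr_powRB1 ?(lt_trans ltr01)// -norm_pflux// -normrM.
by rewrite /pflux mulrCA ger0_norm// mulr_ge0 ?powR_ge0// -expr2 sqr_ge0.
Qed.

Lemma pflux_gt0 (R : realType) (p x : R) : (0 < pflux p x) = (0 < x).
Proof.
have [->|x0] := eqVneq x 0; first by rewrite /pflux mulr0.
by rewrite /pflux pmulr_rgt0// powR_gt0 ?normr_gt0.
Qed.

Lemma pflux_lt0 (R : realType) (p x : R) : (pflux p x < 0) = (x < 0).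
Proof. by rewrite -oppr_gt0 -pfluxN pflux_gt0 oppr_gt0. Qed.

Lemma continuous_pflux (R : realType) (p : R) : 1 < p -> continuous (pflux p).
Proof.
move=> p1 x; have [->|x0] := eqVneq x 0.
  (* near 0 the exponent p - 2 may be negative, but |pflux p s| = |s|^(p - 1) *)
  have q0 : 0 < p - 1 by rewrite subr_gt0.
  apply/cvgrPdist_lt => e e0; near=> s.
  rewrite {1}/pflux mulr0 sub0r normrN norm_pflux//.
  have -> : e = (e `^ (p - 1)^-1) `^ (p - 1).
    by rewrite -powRrM mulVf ?gt_eqF// powRr1// ltW.
  rewrite gt0_ltr_powR ?nnegrE ?powR_ge0//.
  near: s; apply: (@cvgr_norm_lt _ _ _ (nbhs (0:R)) _ id 0).
    exact: cvg_id.
  by rewrite normr0 powR_gt0.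
apply: cvgM; last exact: cvg_id.
apply: (@cvg_comp _ _ _ (fun y : R => `|y|) (@powR R ^~ (p - 2))
  (nbhs x) (nbhs `|x|)).
  exact: norm_continuous.
apply: (@differentiable_continuous _ _ _ (`|x|) (@powR R ^~ (p - 2))).
apply/derivable1_diffP.
by apply: derivable_powR; rewrite in_itv/= andbT normr_gt0.
Unshelve. all: by end_near. Qed.

(** The convexity of |x|^p as a tangent inequality: by [mul_pflux] this reads
    |b|^p + p |b|^(p-2) b (a - b) <= |a|^p. *)
Lemma pflux_convex (R : realType) (p a b : R) : 1 < p ->
  b * pflux p b + p * (pflux p b * (a - b)) <= a * pflux p a.
Proof.
move=> p1; have p0 : 0 < p by apply: lt_trans p1.
have q0 : 0 < p - 1 by rewrite subr_gt0.
have qq : (p / (p - 1))^-1 = (p - 1) / p by rewrite invf_div.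
have : pflux p b * a <= `|a| `^ p / p + `|b| `^ p * ((p - 1) / p).
  apply: (le_trans (ler_norm _)); rewrite normrM norm_pflux// mulrC.
  have pq : p^-1 + (p / (p - 1))^-1 = 1 by rewrite qq; field; rewrite gt_eqF.
  (* Young's inequality for |a| and |b|^(p - 1) *)
  have := conjugate_powR (normr_ge0 a) (powR_ge0 `|b| (p - 1)) p0
    (divr_gt0 p0 q0) pq.
  by rewrite -powRrM mulrCA divff ?gt_eqF// mulr1 qq.
rewrite -!mul_pflux// -(ler_pM2l p0) => h.
have e : p * (a * pflux p a / p + b * pflux p b * ((p - 1) / p)) =
   a * pflux p a + (p - 1) * (b * pflux p b) by field; rewrite gt_eqF.
move: h; rewrite e; lra.
Qed.

(** * The p-energy and summation by parts *)

Section Graph.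
Variables (R : realType) (p : R) (V : finType) (adj : rel V).
Variables (mu : V -> R) (omega : V -> V -> R).
Hypotheses (p1 : 1 < p) (adjC : symmetric adj) (mu0 : vertex_measure mu).
Hypothesis homega : edge_measure adj omega.
Hypothesis hconn : connected_graph adj.
Notation pLap := (pLaplacian adj mu omega p).

(** The differential at u, in the direction phi, of the p-energy defined below,
    divided by p.  The sum runs over ordered pairs, so each edge is counted twice. *)
Definition dpairing (u phi : V -> R) : R :=
  \sum_i \sum_(j | adj i j) omega i j * pflux p (u j - u i) * (phi j - phi i).

(** The p-energy, \sum omega_ij |u_j - u_i|^p over ordered pairs of adjacent
    vertices; see [penergyE]. *)
Definition penergy (u : V -> R) : R := dpairing u u.

(** Summation by parts. *)
Lemma dpairing_pLaplacian (u phi : V -> R) :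
  dpairing u phi = - (2 * \sum_i phi i * (mu i * pLap u i)).
Proof.
pose a i j := omega i j * pflux p (u j - u i).
have L i : mu i * pLap u i = \sum_(j | adj i j) a i j.
  rewrite /pLaplacian mulrA mulfV ?gt_eqF// mul1r.
  by apply: eq_bigr => j _; rewrite /a /pflux mulrA.
(* a is antisymmetric: exchange the two ends of each edge *)
have sw : \sum_i \sum_(j | adj i j) a i j * phi j =
   - \sum_i phi i * \sum_(j | adj i j) a i j.
  rewrite (exchange_big_dep predT)//= -sumrN; apply: eq_bigr => j _.
  rewrite -mulrN -sumrN mulr_sumr.
  apply: eq_big => [i|i aij]; first exact: adjC.
  by rewrite /a (homega aij).2 -(opprB (u i)) pfluxN; ring.
transitivity (\sum_i \sum_(j | adj i j) a i j * phi j -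
              \sum_i phi i * \sum_(j | adj i j) a i j).
  rewrite -sumrB; apply: eq_bigr => i _; rewrite mulr_sumr -sumrB.
  by apply: eq_bigr => j _; rewrite /a; ring.
rewrite sw; under [in RHS]eq_bigr do rewrite L.
by ring.
Qed.

Lemma penergyE u : penergy u =
  \sum_i \sum_(j | adj i j) omega i j * `|u j - u i| `^ p.
Proof.
apply: eq_bigr => i _; apply: eq_bigr => j _.
by rewrite -mul_pflux//; ring.
Qed.

Lemma edge_le_penergy u i j :
  adj i j -> omega i j * `|u j - u i| `^ p <= penergy u.
Proof.
have t0 a b : adj a b -> 0 <= omega a b * `|u b - u a| `^ p.
  by move=> /homega[w0 _]; rewrite mulr_ge0 ?powR_ge0 ?ltW.
move=> ij; rewrite penergyE (bigD1 i)//= (bigD1 j)//= -addrA lerDl addr_ge0//.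
  by apply: sumr_ge0 => k /andP[ik _]; exact: t0.
by apply: sumr_ge0 => k _; apply: sumr_ge0 => l; exact: t0.
Qed.

Lemma penergy_convex v w :
  penergy v + p * dpairing v (fun i => w i - v i) <= penergy w.
Proof.
rewrite mulr_sumr -big_split/=; apply: ler_sum => i _.
rewrite mulr_sumr -big_split/=; apply: ler_sum => j /homega[w0 _].
have := pflux_convex (w j - w i) (v j - v i) p1.
move=> /(ler_wpM2l (ltW w0)); lra.
Qed.

Lemma penergy_shift c u : penergy (fun i => u i + c) = penergy u.
Proof.
apply: eq_bigr => i _; apply: eq_bigr => j _.
by have -> : u j + c - (u i + c) = u j - u i by ring.
Qed.

Lemma eq_edges_cst (u : V -> R) : (forall i j, adj i j -> u i = u j) ->
  forall i j, u i = u j.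
Proof.
move=> e i j.
apply: (@connect_ind _ adj (fun k => u i = u k)) (hconn i j) _ => //.
by move=> k l /e <-.
Qed.

Lemma penergy_eq0_cst u : penergy u <= 0 -> forall i j, u i = u j.
Proof.
move=> E0; apply: eq_edges_cst => i j ij.
have := le_trans (edge_le_penergy u ij) E0.
rewrite pmulr_rle0 ?(homega ij).1// => h; apply/eqP; rewrite eq_sym -subr_eq0.
by rewrite -normr_le0 leNgt; apply/negP => /(powR_gt0 p); rewrite ltNge h.
Qed.

(** Bounded energy bounds every coordinate of a function pinned to 0 at i0; the
    bound may depend on the vertex. *)
Lemma penergy_coercive (M : R) (i0 i : V) : exists B : R,
  forall u : V -> R, penergy u <= M -> u i0 = 0 -> `|u i| <= B.
Proof.
apply: (@connect_ind _ adj (fun k => exists B : R,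
  forall u : V -> R, penergy u <= M -> u i0 = 0 -> `|u k| <= B)) (hconn i0 i) _.
  move=> j k jk [B HB]; exists (B + (1 + M / omega j k)) => u uM u0.
  have -> : u k = u j + (u k - u j) by ring.
  apply: (le_trans (ler_normD _ _)); apply: lerD; first exact: HB.
  have : `|u k - u j| `^ p <= M / omega j k.
    rewrite ler_pdivlMr ?(homega jk).1// mulrC.
    exact: le_trans (edge_le_penergy _ jk) uM.
  (* either |d| <= 1, or |d| <= |d|^p *)
  move=> h; have [le1|/ltW ge1] := leP `|u k - u j| 1.
    by rewrite (le_trans le1)// lerDl (le_trans _ h)// powR_ge0.
  apply: (le_trans (le1r_powR ge1 (ltW p1))); apply: (le_trans h).
  by rewrite lerDr.
by exists 0 => u _ ->; rewrite normr0.
Qed.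

Lemma pLap_eq0_cst u : (forall i, pLap u i = 0) -> forall i j, u i = u j.
Proof.
move=> L0; apply: penergy_eq0_cst.
rewrite /penergy dpairing_pLaplacian big1 ?mulr0 ?oppr0// => i _.
by rewrite L0 !mulr0.
Qed.

(** * The weighted exponential sum *)

Variable h : V -> R.

(** G u, the integral of h e^u against mu. *)
Definition weight (u : V -> R) : R := \sum_i mu i * h i * expR (u i).

Lemma weight_shift c u : weight (fun i => u i + c) = expR c * weight u.
Proof.
rewrite mulr_sumr; apply: eq_bigr => i _; rewrite expRD; ring.
Qed.

(** A function that is 0 at i0 and sufficiently negative elsewhere. *)
Lemma weight_ge0_nonempty i0 :
  0 < h i0 -> exists u, u i0 = 0 /\ 0 <= weight u.
Proof.
move=> h0; pose a := mu i0 * h i0; pose C := \sum_(i | i != i0) `|mu i * h i|.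
have a0 : 0 < a by rewrite mulr_gt0.
have C0 : 0 <= C by apply: sumr_ge0.
have aC : 0 < a + C by rewrite ltr_wpDr.
(* the other vertices contribute at least - C * (a / (a + C)) >= - a *)
exists (fun i => if i == i0 then 0 else ln (a / (a + C))).
split; first by rewrite eqxx.
rewrite /weight (bigD1 i0)//= eqxx expR0 mulr1 -/a.
have -> : \sum_(i | i != i0)
    mu i * h i * expR (if i == i0 then 0 else ln (a / (a + C))) =
    (a / (a + C)) * \sum_(i | i != i0) mu i * h i.
  rewrite mulr_sumr; apply: eq_bigr => i /negbTE ->.
  by rewrite lnK ?posrE ?divr_gt0// mulrC.
have : - C <= \sum_(i | i != i0) mu i * h i.
  by rewrite -sumrN; apply: ler_sum => i _; rewrite lerNl -normrN ler_norm.
move=> /(ler_wpM2l (ltW (divr_gt0 a0 aC))) le.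
rewrite -lerBlDl sub0r; apply: (le_trans _ le); rewrite mulrN lerN2.
rewrite -mulrA ler_piMr ?(ltW a0)// mulrC ler_pdivrMr// mul1r.
by rewrite lerDr ltW.
Qed.

(** * Necessary conditions *)

Lemma weight_solution u :
  (forall i, pLap u i = - h i * expR (u i)) -> weight u = 0.
Proof.
move=> eqn; have := dpairing_pLaplacian u (fun=> 1).
have -> : dpairing u (fun=> 1) = 0.
  by apply: big1 => i _; apply: big1 => j _; rewrite subrr mulr0.
have -> : \sum_i 1 * (mu i * pLap u i) = - weight u.
  by rewrite -sumrN; apply: eq_bigr => i _; rewrite eqn; ring.
lra.
Qed.

Lemma weight_eq0_changes_sign u : ~ (forall i, h i = 0) -> weight u = 0 ->
  changes_sign h.
Proof.
have t0 i : 0 < mu i * expR (u i) by rewrite mulr_gt0 ?expR_gt0.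
have E i : mu i * h i * expR (u i) = mu i * expR (u i) * h i by ring.
move=> hh w0; split; apply: contrapT => no; apply: hh => i.
  have hle k : h k <= 0 by rewrite leNgt; apply/negP => hk; apply: no; exists k.
  have le k : 0 <= - (mu k * h k * expR (u k)) by rewrite oppr_ge0 E pmulr_rle0.
  have /eqP : \sum_k - (mu k * h k * expR (u k)) = 0.
    by rewrite sumrN -/(weight u) w0 oppr0.
  rewrite psumr_eq0// => /allP/(_ i (mem_index_enum _))/=.
  by rewrite oppr_eq0 E mulf_eq0 gt_eqF//= => /eqP.
have hge k : 0 <= h k by rewrite leNgt; apply/negP => hk; apply: no; exists k.
have ge k : 0 <= mu k * h k * expR (u k) by rewrite E pmulr_rge0.
move/eqP: w0; rewrite psumr_eq0// => /allP/(_ i (mem_index_enum _))/=.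
by rewrite E mulf_eq0 gt_eqF//= => /eqP.
Qed.

(** The test function e^(-u) gives a nonpositive value, zero only if u is
    constant: exp (- _) reverses the sign of u_j - u_i on every edge. *)
Lemma dpairing_expRN u : dpairing u (fun i => expR (- u i)) <= 0 /\
  (dpairing u (fun i => expR (- u i)) = 0 -> forall i j, u i = u j).
Proof.
pose T i j := omega i j * pflux p (u j - u i) * (expR (- u j) - expR (- u i)).
have Tlt i j : adj i j -> u i != u j -> T i j < 0.
  move=> ij; have w0 := (homega ij).1; rewrite neq_lt => /orP[lt|lt].
    rewrite nmulr_llt0 ?subr_lt0 ?ltr_expR ?ltrN2//.
    by rewrite mulr_gt0 ?pflux_gt0 ?subr_gt0.
  rewrite nmulr_rlt0 ?subr_gt0 ?ltr_expR ?ltrN2//.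
  by rewrite nmulr_llt0 ?pflux_lt0 ?subr_lt0.
have Tle i j : adj i j -> T i j <= 0.
  move=> ij; have [e|ne] := eqVneq (u i) (u j); last exact/ltW/Tlt.
  by rewrite /T e !subrr mulr0.
split; first by apply: sumr_le0 => i _; apply: sumr_le0 => j; exact: Tle.
move=> D0; apply: eq_edges_cst => i j ij; apply/eqP; apply: contraT => ne.
have sle k : \sum_(l | adj k l) T k l <= 0 by apply: sumr_le0 => l; exact: Tle.
have : dpairing u (fun i => expR (- u i)) < 0.
  rewrite /dpairing (bigD1 i)//= ltr_wnDr//; first by apply: sumr_le0.
  rewrite (bigD1 j)//= ltr_wnDr//; last exact: Tlt.
  by apply: sumr_le0 => l /andP[il _]; exact: Tle.
by rewrite D0 ltxx.
Qed.

Lemma sum_mu_gt0 (i0 : V) : 0 < \sum_i mu i.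
Proof.
rewrite (bigD1 i0)//= ltr_pwDl//; apply: sumr_ge0 => i _; exact/ltW/mu0.
Qed.

Lemma average_lt0 (i0 : V) : (average mu h < 0) = (\sum_i mu i * h i < 0).
Proof. by rewrite /average pmulr_llt0// invr_gt0 sum_mu_gt0. Qed.

Lemma solution_sum_lt0 u : ~ (forall i, h i = 0) ->
  (forall i, pLap u i = - h i * expR (u i)) -> \sum_i mu i * h i < 0.
Proof.
move=> hh eqn; have [le0 eq0] := dpairing_expRN u.
have D : dpairing u (fun i => expR (- u i)) = 2 * \sum_i mu i * h i.
  rewrite dpairing_pLaplacian -mulrN -sumrN; congr (_ * _).
  apply: eq_bigr => i _; rewrite eqn expRN; by field; rewrite gt_eqF ?expR_gt0.
rewrite lt_neqAle; apply/andP; split; last by move: le0; rewrite D; lra.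
apply/negP => /eqP s0; apply: hh => i.
rewrite D s0 mulr0 in eq0.
have L0 : pLap u i = 0.
  rewrite /pLaplacian big1 ?mulr0// => j _.
  by rewrite (eq0 erefl i j) subrr mulr0.
move/eqP: (eqn i); rewrite L0 eq_sym mulf_eq0 oppr_eq0 => /orP[/eqP//|].
by rewrite gt_eqF ?expR_gt0.
Qed.

(** * Existence of a constrained minimiser *)

(* V -> R carries the product topology, so boxes are compact. *)
Section PointwiseTopology.
Import ArrowAsProduct.

Lemma continuous_penergy : continuous (penergy : (V -> R) -> R).
Proof.
have cu i : continuous (fun v : V -> R => v i).
  exact: (@proj_continuous V (fun=> R) i).
apply: (@continuous_bigsum _ V predT (V -> R) (fun i u => \sum_(j | adj i j)
  omega i j * pflux p (u j - u i) * (u j - u i))) => i _.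
apply: (@continuous_bigsum _ V (adj i) (V -> R) (fun j u =>
  omega i j * pflux p (u j - u i) * (u j - u i))) => j _.
have cd : continuous (fun v : V -> R => v j - v i).
  by move=> v; exact: (cvgB (cu j v) (cu i v)).
have cf : continuous (fun v : V -> R => pflux p (v j - v i)).
  by move=> u; exact: (cvg_comp _ _ (cd u) (@continuous_pflux _ _ p1 _)).
have cc : continuous (fun v : V -> R => omega i j * pflux p (v j - v i)).
  move=> u; have c := @cvgMl_tmp _ _ (nbhs u) _ _ (omega i j) _ (cf u).
  exact: c.
by move=> u; exact: (cvgM (cc u) (cd u)).
Qed.

Lemma continuous_weight : continuous weight.
Proof.
apply: (@continuous_bigsum _ V predT (V -> R)
  (fun i u => mu i * h i * expR (u i))) => i _ u.
have cu := @proj_continuous V (fun=> R) i u.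
have ce := cvg_comp _ _ cu (@continuous_expR _ _).
have c := @cvgMl_tmp _ _ (nbhs u) _ _ (mu i * h i) _ ce; exact: c.
Qed.

Lemma penergy_min_on_weight i0 : 0 < h i0 -> exists2 u, 0 <= weight u &
  forall w, 0 <= weight w -> penergy u <= penergy w.
Proof.
move=> h0; have [v [v0 wv]] := weight_ge0_nonempty h0.
have /choice[B HB] := fun i => penergy_coercive (penergy v) i0 i.
(* A contains every competitor that vanishes at i0 and does at least as
   well as v *)
pose A : set (V -> R) := [set u | forall i, `[- B i, B i]%classic (u i)] `&`
   [set u | 0 <= weight u].
have inA u : 0 <= weight u -> u i0 = 0 -> penergy u <= penergy v -> A u.
  move=> wu u0 uv; split=> //= i; rewrite in_itv/= -ler_norml; exact: HB.
have cA : compact A.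
  apply: compact_closedI.
    apply: (@tychonoff V (fun=> R) (fun i => `[- B i, B i]%classic)) => i.
    exact: segment_compact.
  apply: (@closed_comp _ _ weight [set x | 0 <= x]); last exact: closed_ge.
  by move=> x _; exact: continuous_weight.
have [||u] := @compact_EVT_min _ R penergy A _ cA.
- by exists v; exact: inA.
- exact: continuous_subspaceT continuous_penergy.
rewrite inE => Au umin; exists u; first exact: Au.2.
(* an arbitrary competitor is translated so as to vanish at i0 *)
move=> w ww; rewrite -(penergy_shift (- w i0) w).
have [wv'|/ltW vw] := leP (penergy (fun i => w i + - w i0)) (penergy v).
  apply: umin; rewrite inE; apply: inA => //; last by rewrite subrr.
  by rewrite weight_shift mulr_ge0 ?expR_ge0.
by apply: le_trans vw; apply: umin; rewrite inE; exact: inA.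
Qed.
End PointwiseTopology.

(** * The minimiser solves the equation up to a constant *)

(** If the derivative of G at u in the direction phi is positive, then
    G (u + t phi) >= G u for small t > 0. *)
Lemma weight_nondecreasing_dir u phi :
  0 < \sum_i mu i * h i * expR (u i) * phi i ->
  \forall t \near 0^'+, weight u <= weight (fun i => u i + t * phi i).
Proof.
(* By convexity of exp, each summand grows by at least t times the corresponding
   summand of S t: the tangent of exp is taken at u_i if h_i >= 0, and at
   u_i + t phi_i if h_i < 0. *)
pose S t := \sum_i mu i * h i * phi i * expR (u i + (h i < 0)%R%:R * phi i * t).
have S0 : S 0 = \sum_i mu i * h i * expR (u i) * phi i.
  by apply: eq_bigr => i _; rewrite mulr0 addr0; ring.
have cS : continuous S.
  apply: (@continuous_bigsum _ V predT R (fun i t =>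
    mu i * h i * phi i * expR (u i + (h i < 0)%R%:R * phi i * t))) => i _ t.
  have cl : u i + (h i < 0)%R%:R * phi i * s @[s --> t] -->
            u i + (h i < 0)%R%:R * phi i * t.
    by apply: cvgD; [exact: cvg_cst | apply: cvgMl_tmp; exact: cvg_id].
  apply: cvgMl_tmp; exact: (cvg_comp _ _ cl (@continuous_expR _ _)).
rewrite -S0 => Spos; near=> t.
have t0 : 0 <= t by near: t; exact: nbhs_right_ge.
have St : 0 < S t.
  near: t; apply: (cvgr_gt (S 0)) => //; apply: cvg_at_right_filter; exact: cS.
rewrite -[leLHS]addr0; apply: (@le_trans _ _ (weight u + t * S t)).
  by rewrite lerD2l mulr_ge0// ltW.
rewrite /weight /S mulr_sumr -big_split/=; apply: ler_sum => i _.
have m0 := mu0 i; have [hi|hi] := ltP (h i) 0.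
  have mh : mu i * h i <= 0 by rewrite nmulr_lle0// ltW.
  have := ler_wnM2l mh (expR_tangent (u i) (u i + t * phi i)).
  rewrite mul1r (mulrC (phi i)) opprD addNKr; lra.
have mh : 0 <= mu i * h i by rewrite mulr_ge0// ltW.
have := ler_wpM2l mh (expR_tangent (u i + t * phi i) (u i)).
rewrite mul0r mul0r addr0; lra.
Unshelve. all: by end_near. Qed.

(** The first-order condition at a constrained minimiser. *)
Lemma minimizer_dpairing_ge0 u phi : 0 <= weight u ->
  (forall w, 0 <= weight w -> penergy u <= penergy w) ->
  0 < \sum_i mu i * h i * expR (u i) * phi i -> 0 <= dpairing u phi.
Proof.
move=> wu umin /weight_nondecreasing_dir wphi.
pose D t := dpairing (fun i => u i + t * phi i) phi.
have D0 : D 0 = dpairing u phi.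
  apply: eq_bigr => i _; apply: eq_bigr => j _.
  by rewrite !mul0r !addr0.
have cD : continuous D.
  pose T i j t := omega i j * pflux p (u j + t * phi j - (u i + t * phi i)) *
    (phi j - phi i).
  apply: (@continuous_bigsum _ V predT R
    (fun i t => \sum_(j | adj i j) T i j t)) => i _.
  apply: (@continuous_bigsum _ V (adj i) R (T i)) => j _ t.
  have cl k : u k + s * phi k @[s --> t] --> u k + t * phi k.
    by apply: cvgD; [exact: cvg_cst | apply: cvgMr_tmp; exact: cvg_id].
  apply: cvgMr_tmp; apply: cvgMl_tmp.
  exact: (cvg_comp _ _ (cvgB (cl j) (cl i)) (@continuous_pflux _ _ p1 _)).
rewrite -D0; apply: (@cvgr_to_ge _ (0^'+) _ _ D).
  by apply: cvg_at_right_filter; exact: cD.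
near=> t.
have t0 : 0 < t by near: t; exact: nbhs_right_gt.
have wt : weight u <= weight (fun i => u i + t * phi i) by near: t.
(* E u >= E (u + t phi) - p t D t and E (u + t phi) >= E u *)
have := penergy_convex (fun i => u i + t * phi i) u.
have -> : dpairing (fun i => u i + t * phi i)
    (fun i => u i - (u i + t * phi i)) = - (t * D t).
  rewrite mulr_sumr -sumrN; apply: eq_bigr => i _.
  rewrite mulr_sumr -sumrN; apply: eq_bigr => j _; ring.
have Ele := umin _ (le_trans wu wt).
move=> le; have : 0 <= p * (t * D t) by lra.
by rewrite !pmulr_rge0// (lt_trans _ p1).
Unshelve. all: by end_near. Qed.

Lemma solution_exists i0 : 0 < h i0 -> \sum_i mu i * h i < 0 ->
  exists u : V -> R, forall i, pLap u i = - h i * expR (u i).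
Proof.
move=> h0 sneg.
have [u wu umin] := penergy_min_on_weight h0.
have [||lam lam0 Llam] := @halfspace_proportional R V
  (fun i => mu i * h i * expR (u i)) (fun i => - (mu i * pLap u i)) i0.
- by rewrite !mulr_gt0 ?expR_gt0.
- move=> phi /(minimizer_dpairing_ge0 wu umin).
  rewrite dpairing_pLaplacian.
  under [X in _ -> 0 <= X]eq_bigr do rewrite mulNr mulrC.
  by rewrite sumrN; lra.
have L i : pLap u i = - (lam * h i * expR (u i)).
  apply: (mulfI (lt0r_neq0 (mu0 i))).
  by apply: oppr_inj; rewrite Llam; ring.
have {lam0} lam0 : 0 < lam.
  rewrite lt_neqAle lam0 andbT eq_sym; apply/negP => /eqP lam_eq0.
  have ucst := @pLap_eq0_cst u.
  have : weight u = expR (u i0) * \sum_i mu i * h i.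
    rewrite mulr_sumr; apply: eq_bigr => i _.
    rewrite (ucst _ i i0) 1?mulrC// => k.
    by rewrite L lam_eq0 !mul0r oppr0.
  by move=> wE; move: wu; rewrite wE pmulr_rge0 ?expR_gt0// leNgt sneg.
exists (fun i => u i + ln lam) => i.
have -> : pLap (fun i => u i + ln lam) i = pLap u i.
  congr (_ * _); apply: eq_bigr => j _.
  by have -> : u j + ln lam - (u i + ln lam) = u j - u i by ring.
by rewrite L expRD lnK ?posrE//; ring.
Qed.

End Graph.

Theorem theorem2p3 (R : realType) (p : R) (V : finType) (adj : rel V)
    (mu : V -> R) (omega : V -> V -> R) (h : V -> R)
    (hp : 1 < p)
    (hG : simple_graph adj)
    (hconn : connected_graph adj)
    (hmu : vertex_measure mu)
    (homega : edge_measure adj omega)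
    (hh : ~ (forall i : V, h i = 0)) :
  (exists u : V -> R,
     forall i : V, pLaplacian adj mu omega p u i = - h i * expR (u i)) <->
  (changes_sign h /\ average mu h < 0).
Proof.
have [adjC _] := hG; split=> [[u eqn]|[[[i0 h0] _]]].
  have w0 := weight_solution adjC hmu homega eqn.
  have cs := weight_eq0_changes_sign hmu hh w0.
  split=> //; have [[i0 _] _] := cs; rewrite (average_lt0 hmu h i0).
  exact: solution_sum_lt0 eqn.
by rewrite (average_lt0 hmu h i0); apply: (solution_exists hp adjC) h0.
Qed.
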